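(* For $p=021$, we have $$C_p(x,y)=\frac{1-4x+6x^2-x^2y-4x^3+3x^3y+x^4-x^4y}{(1-x)(1-2x)(1-2x+x^2-x^2y)}.$$
   Context: A Catalan word of length $n\geq 1$ is a word $w_1\ldots w_n$ over the non-negative integers with $w_1=0$ and $0\leq w_i\leq w_{i-1}+1$ for $2\leq i\leq n$; the empty word is the unique Catalan word of length $0$. A word $w$ contains the pattern $p=p_1\ldots p_k$ if there are indices $i_1<\cdots<i_k$ such that $w_{i_1}\ldots w_{i_k}$ is order-isomorphic to $p$ (for all $a,b$: $w_{i_a}<w_{i_b}$ iff $p_a<p_b$, and $w_{i_a}=w_{i_b}$ iff $p_a=p_b$); otherwise $w$ avoids $p$. $\mathcal{C}_n(p)$ is the set of Catalan words of length $n$ avoiding $p$. A descent of $w$ is an index $i$ with $w_i>w_{i+1}$. $C_p(x,y)=\sum_{n,k\geq 0}c_{n,k}x^ny^k$, where $c_{n,k}$ is the number of words in $\mathcal{C}_n(p)$ with exactly $k$ descents. *)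

(* Defs.v *)
From HB Require Import structures.
From mathcomp Require Import all_boot all_order all_algebra.
From mathcomp Require Import boolp.

Set Implicit Arguments.
Unset Strict Implicit.
Unset Printing Implicit Defensive.

Import GRing.Theory.
Local Open Scope ring_scope.

(* Formal power series R[[t]].  Wrapping the coefficient function in a record
   keeps the Cauchy product from clashing with the pointwise ring structure
   that the libraries put on function types. *)
Record fps (R : Type) := Fps { fcoef : nat -> R }.

HB.instance Definition _ (R : Type) := gen_eqMixin (fps R).
HB.instance Definition _ (R : Type) := gen_choiceMixin (fps R).

Lemma fpsP (R : Type) (f g : fps R) : fcoef f =1 fcoef g <-> f = g.
Proof. by split=> [|-> //]; case: f g => [f] [g] /= /funext ->. Qed.

Section FpsZmodule.
Variable R : zmodType.
Implicit Types f g h : fps R.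

Definition fps_zero : fps R := Fps (fun=> 0).
Definition fps_opp f := Fps (fun n => - fcoef f n).
Definition fps_add f g := Fps (fun n => fcoef f n + fcoef g n).

Fact fps_addA : associative fps_add.
Proof. by move=> f g h; apply/fpsP => n /=; rewrite addrA. Qed.
Fact fps_addC : commutative fps_add.
Proof. by move=> f g; apply/fpsP => n /=; rewrite addrC. Qed.
Fact fps_add0 : left_id fps_zero fps_add.
Proof. by move=> f; apply/fpsP => n /=; rewrite add0r. Qed.
Fact fps_addN : left_inverse fps_zero fps_opp fps_add.
Proof. by move=> f; apply/fpsP => n /=; rewrite addNr. Qed.

HB.instance Definition _ :=
  GRing.isZmodule.Build (fps R) fps_addA fps_addC fps_add0 fps_addN.

End FpsZmodule.

Section FpsRing.
Variable R : comNzRingType.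
Implicit Types f g h : fps R.

Definition fpsC (c : R) : fps R := Fps (fun n => if n == 0%N then c else 0).
Definition fpsX : fps R := Fps (fun n => (n == 1%N)%:R).

Definition fps_mul f g : fps R :=
  Fps (fun n => \sum_(i < n.+1) fcoef f i * fcoef g (n - i)).

Let trunc m f : {poly R} := \poly_(i < m.+1) fcoef f i.

Let truncE m f i : (i <= m)%N -> (trunc m f)`_i = fcoef f i.
Proof. by move=> le_im; rewrite coef_poly ltnS le_im. Qed.

Let fps_mulE m f g i :
  (i <= m)%N -> fcoef (fps_mul f g) i = (trunc m f * trunc m g)`_i.
Proof.
move=> le_im; rewrite coefM; apply: eq_bigr => j _.
have le_ji : (j <= i)%N by rewrite -ltnS.
by rewrite !truncE ?(leq_trans _ le_im) ?leq_subr.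
Qed.

Fact fps_mulA : associative fps_mul.
Proof.
move=> f g h; apply/fpsP => n.
transitivity ((trunc n f * (trunc n g * trunc n h))`_n).
  rewrite coefM; apply: eq_bigr => j _.
  have le_jn : (j <= n)%N by rewrite -ltnS.
  by rewrite truncE // (@fps_mulE n) ?leq_subr.
rewrite mulrA coefM; apply: eq_bigr => j _.
have le_jn : (j <= n)%N by rewrite -ltnS.
by rewrite truncE ?leq_subr // (@fps_mulE n).
Qed.

Fact fps_mulC : commutative fps_mul.
Proof. by move=> f g; apply/fpsP => n; rewrite !(@fps_mulE n) // mulrC. Qed.

Fact fps_mul1 : left_id (fpsC 1) fps_mul.
Proof.
move=> f; apply/fpsP => n /=.
by rewrite big_ord_recl /= mul1r subn0 big1 ?addr0 // => i _; rewrite mul0r.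
Qed.

Fact fps_mulDl : left_distributive fps_mul (@fps_add R).
Proof.
move=> f g h; apply/fpsP => n /=.
by rewrite -big_split /=; apply: eq_bigr => i _; rewrite mulrDl.
Qed.

Fact fps_one_neq0 : fpsC 1 != 0.
Proof.
by apply/eqP => /fpsP /(_ 0%N) /= /eqP; rewrite oner_eq0.
Qed.

HB.instance Definition _ := GRing.Zmodule_isComNzRing.Build (fps R)
  fps_mulA fps_mulC fps_mul1 fps_mulDl fps_one_neq0.

End FpsRing.

Section FpsUnitRing.
Variable R : comUnitRingType.
Implicit Types f g h : fps R.

Definition fps_unit : {pred fps R} :=
  fun f => fcoef f 0 \is a GRing.unit.

(* The first n coefficients of 1 / f, obtained by solving
   f_0 g_0 = 1 and f_0 g_n + sum_(i < n) f_(n-i) g_i = 0. *)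
Fixpoint fps_inv_seq f n : seq R :=
  if n is m.+1 then
    let s := fps_inv_seq f m in
    rcons s ((fcoef f 0)^-1 *
             ((m == 0%N)%:R - \sum_(i < m) fcoef f (m - i) * s`_i))
  else [::].

Definition fps_inv f : fps R :=
  if f \in fps_unit then Fps (fun n => (fps_inv_seq f n.+1)`_n) else f.

Let size_inv_seq f n : size (fps_inv_seq f n) = n.
Proof. by elim: n => //= n IHn; rewrite size_rcons IHn. Qed.

Let nth_inv_seq f n i :
  (i < n)%N -> (fps_inv_seq f n)`_i = (fps_inv_seq f i.+1)`_i.
Proof.
elim: n => // n IHn; rewrite ltnS leq_eqVlt => /predU1P[-> // | lt_in].
by rewrite {1}/fps_inv_seq -/fps_inv_seq nth_rcons size_inv_seq lt_in IHn.
Qed.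

Fact fps_mulV : {in fps_unit, left_inverse 1 fps_inv *%R}.
Proof.
move=> f Uf; rewrite /fps_inv Uf; apply/fpsP => n.
rewrite [LHS]/= big_ord_recr /= subnn nth_rcons size_inv_seq ltnn eqxx.
rewrite [_ * fcoef f 0]mulrC mulVKr //.
rewrite (eq_bigr (fun i : 'I_n => fcoef f (n - i) * (fps_inv_seq f n)`_i)).
  by rewrite addrC subrK; case: n.
by move=> i _; rewrite mulrC (@nth_inv_seq f n i).
Qed.

Fact fps_unitPl f g : g * f = 1 -> fps_unit f.
Proof.
move/fpsP/(_ 0%N); rewrite /= big_ord1 /= => gf1.
by apply/unitrPr; exists (fcoef g 0); rewrite mulrC.
Qed.

Fact fps_inv_out : {in [predC fps_unit], fps_inv =1 id}.
Proof. by move=> f; rewrite inE /= /fps_inv => /negbTE ->. Qed.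

HB.instance Definition _ := GRing.ComNzRing_hasMulInverse.Build (fps R)
  fps_mulV fps_unitPl fps_inv_out.

Lemma fps_unitE f : (f \is a GRing.unit) = (fcoef f 0 \is a GRing.unit).
Proof. by []. Qed.

End FpsUnitRing.

(* Z[[x, y]], presented as Z[[y]][[x]]. *)
Notation fps2 := (fps (fps int)).

Definition varx : fps2 := @fpsX (fps int).
Definition vary : fps2 := fpsC (@fpsX int).

Local Open Scope nat_scope.

(* Letters are indexed from 0. *)
Definition catalan_word (w : seq nat) : bool :=
  (nth 0 w 0 == 0) &&
  [forall i : 'I_(size w).-1, nth 0 w i.+1 <= (nth 0 w i).+1].

Definition contains_pattern (p w : seq nat) : bool :=
  [exists i : {ffun 'I_(size p) -> 'I_(size w)},
     [forall a : 'I_(size p), forall b : 'I_(size p),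
       [&& (a < b) ==> (i a < i b),
           (nth 0 w (i a) < nth 0 w (i b)) == (nth 0 p a < nth 0 p b)
         & (nth 0 w (i a) == nth 0 w (i b)) == (nth 0 p a == nth 0 p b)]]].

Definition avoids_pattern (p w : seq nat) : bool := ~~ contains_pattern p w.

Definition descents (w : seq nat) : nat :=
  #|[set i : 'I_(size w).-1 | nth 0 w i.+1 < nth 0 w i]|.

(* The words of length n are taken over the alphabet {0, ..., n - 1}, which
   loses nothing by this lemma. *)
Lemma catalan_word_bound (w : seq nat) :
  catalan_word w -> all (fun a => a < size w) w.
Proof.
case/andP=> /eqP w0 /forallP stepw; apply/(all_nthP 0) => i lt_iw.
suff le_wi : nth 0 w i <= i by apply: leq_ltn_trans lt_iw.
elim: i lt_iw => [|i IHi] lt_iw; first by rewrite w0.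
have lt_i : i < (size w).-1 by rewrite -ltnS prednK // (leq_trans _ lt_iw).
by apply: leq_trans (stepw (Ordinal lt_i)) _; rewrite ltnS IHi // ltnW.
Qed.

Definition catalan_words (p : seq nat) (n : nat) : {set n.-tuple 'I_n} :=
  [set w : n.-tuple 'I_n |
     catalan_word (map val w) && avoids_pattern p (map val w)].

Definition catalan_num (p : seq nat) (n k : nat) : nat :=
  #|[set w in catalan_words p n | descents (map val (w : n.-tuple 'I_n)) == k]|.

Definition catalan_gf (p : seq nat) : fps2 :=
  Fps (fun n => Fps (fun k => (catalan_num p n k)%:Z)).

(* Main.v *)
Require Import Defs.
From HB Require Import structures.
From mathcomp Require Import all_boot all_order all_algebra.
From mathcomp Require Import zify ring.

(** A nonempty Catalan word starts with 0, so it avoids 021 exactly when its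
    positive letters form a weakly increasing sequence.  Such words are read
    from left to right while recording the last letter l and the maximum M so
    far: the next letter is 0 or lies between M and l + 1.  Since 0 can only be
    followed by 0 or 1, a word that returns to 0 after its maximum exceeded 1
    ends in zeros, and for M >= 2 the continuations do not depend on M.  This
    leaves five states (l, M), namely (0,0), (1,1), (0,1), (2,2) and (0,2), and
    a linear system for the generating functions of their continuations. *)

Import GRing.Theory.
Local Open Scope ring_scope.

(** * Coefficients of sums and products of power series *)

Lemma fcoef_sum (R : zmodType) (I : Type) (r : seq I) (F : I -> fps R) n :
  fcoef (\sum_(i <- r) F i) n = \sum_(i <- r) fcoef (F i) n.
Proof. by elim: r => [|i r IHr]; rewrite ?big_nil // !big_cons -IHr. Qed.

Lemma fcoef_Xmul (R : comNzRingType) (f : fps R) n :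
  fcoef (fpsX R * f) n = if n is m.+1 then fcoef f m else 0.
Proof.
case: n => [|n]; first by rewrite /= big_ord1 /= mul0r.
rewrite [LHS]/= !big_ord_recl /= mul0r add0r mul1r subSS subn0.
by rewrite big1 ?addr0 // => i _; rewrite mul0r.
Qed.

Lemma fcoef_one_addX (R : comNzRingType) (f : fps R) n :
  fcoef (1 + fpsX R * f) n = if n is m.+1 then fcoef f m else 1.
Proof.
by rewrite -[LHS]/(fcoef 1 n + fcoef (_ * _) n) fcoef_Xmul;
  case: n => [|n]; rewrite ?addr0 ?add0r.
Qed.

Lemma fcoef_Cmul (R : comNzRingType) (c : R) (f : fps R) n :
  fcoef (fpsC c * f) n = c * fcoef f n.
Proof.
rewrite [LHS]/= big_ord_recl /= subn0 big1 ?addr0 // => i _.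
by rewrite mul0r.
Qed.

(** * Words avoiding 021 as extensions of the letter 0 *)

Section Words.
Local Open Scope nat_scope.

(** The leading 0 can serve as the smallest letter of the pattern, so an occurrence of 021 amounts
    to two positive letters in decreasing order. *)
Lemma avoids_021E (s : seq nat) :
  avoids_pattern [:: 0; 2; 1] (0 :: s) =
  pairwise (fun a b => (b == 0) || (a <= b)) (0 :: s).
Proof.
set w := 0 :: s; set r := fun a b => _.
apply/idP/(pairwiseP 0) => [avw i j lt_iw lt_jw lt_ij | incw].
  rewrite /r; apply: contraNT avw; rewrite negb_or -ltnNge -lt0n.
  move=> /andP[wj_gt0 wj_lt].
  have i_gt0 : 0 < i by case: i wj_lt {lt_iw lt_ij}.
  apply/existsP; exists [ffun a : 'I_3 =>
    nth (@ord0 (size s)) [:: ord0; Ordinal lt_iw; Ordinal lt_jw] a].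
  have gt_ji : nth 0 w j < nth 0 w i by [].
  by apply/forallP => -[[|[|[|//]]] ?]; apply/forallP => -[[|[|[|//]]] ?];
    rewrite !ffunE /=; lia.
apply/negP => /existsP[i /forallP inc_i].
have /forallP i0 := inc_i (@Ordinal 3 0 isT).
have /forallP i1 := inc_i (@Ordinal 3 1 isT).
have /and3P[_ /= /eqP lt02 _] := i0 (@Ordinal 3 2 isT).
have /and3P[/= lt_i12 /eqP lt12 /eqP eq12] := i1 (@Ordinal 3 2 isT).
move: (incw _ _ (ltn_ord (i (@Ordinal 3 1 isT)))
                (ltn_ord (i (@Ordinal 3 2 isT))) lt_i12).
by rewrite /r leq_eqVlt eq12 lt12 orbF => /eqP w2_eq0; rewrite w2_eq0 in lt02.
Qed.

Lemma catalan_wordE (s : seq nat) :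
  catalan_word (0 :: s) = path (fun a b => b <= a.+1) 0 s.
Proof.
rewrite /catalan_word /=; apply/forallP/(pathP 0) => [st i lt_is | st i].
  exact: (st (Ordinal lt_is)).
exact: st.
Qed.

Fixpoint extends (l M : nat) (s : seq nat) : bool :=
  if s is a :: s' then
    [&& a <= l.+1, (a == 0) || (M <= a) & extends a (maxn M a) s']
  else true.

Lemma extendsE l M s :
  extends l M s = path (fun a b => b <= a.+1) l s &&
                  pairwise (fun a b => (b == 0) || (a <= b)) (M :: s).
Proof.
elim: s l M => [|a s IHs] l M //=; rewrite IHs /=.
have -> : all (fun b => (b == 0) || (maxn M a <= b)) s =
   all (fun b => (b == 0) || (M <= b)) s && all (fun b => (b == 0) || (a <= b)) s.
  by rewrite -all_predI; apply: eq_all => b /=; lia.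
by rewrite -!andbA; do !bool_congr.
Qed.

Lemma catalan_avoids_021 w :
  catalan_word w && avoids_pattern [:: 0; 2; 1] w =
  if w is a :: s then (a == 0) && extends 0 0 s else true.
Proof.
case: w => [|[|a] s].
- rewrite /catalan_word /=; apply/andP; split; first by apply/forallP => -[].
  by apply/negP => /existsP[i _]; case: (i (@Ordinal 3 0 isT)).
- by rewrite catalan_wordE avoids_021E extendsE.
- by [].
Qed.

Fixpoint descents_from (l : nat) (s : seq nat) : nat :=
  if s is a :: s' then (a < l) + descents_from a s' else 0.

Lemma descents_cons l s : descents (l :: s) = descents_from l s.
Proof.
rewrite /descents cardsE -sum1_card big_mkcond /=.
elim: s l => [|a s IHs] l; first by rewrite big_ord0.
by rewrite big_ord_recl [RHS]/= -IHs.
Qed.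

(** Starting the interval at [maxn 1 M] keeps 0 from being listed twice when [M] is 0. If [M]
    exceeds [l.+1], the truncated subtraction leaves only the letter 0. *)
Definition next_letters (l M : nat) : seq nat :=
  0 :: iota (maxn 1 M) (l.+2 - maxn 1 M).

Lemma mem_next_letters l M a :
  (a \in next_letters l M) = (a <= l.+1) && ((a == 0) || (M <= a)).
Proof. by rewrite inE mem_iota; lia. Qed.

Lemma next_letters_uniq l M : uniq (next_letters l M).
Proof. by rewrite /= iota_uniq mem_iota andbT; lia. Qed.

Fixpoint extensions (n l M : nat) : seq (seq nat) :=
  if n is n'.+1 then
    [seq a :: s | a <- next_letters l M, s <- extensions n' a (maxn M a)]
  else [:: [::]].

Lemma mem_extensions n l M s :
  (s \in extensions n l M) = (size s == n) && extends l M s.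
Proof.
elim: n l M s => [|n IHn] l M s; first by case: s.
apply/allpairsPdep/idP => [[a [t [a_in t_in ->]]] | ].
  by move: a_in t_in; rewrite mem_next_letters IHn /= eqSS => /andP[-> ->].
case: s => //= a s; rewrite eqSS => /and4P[sz_s le_a Ma ext_s].
by exists a, s; split; rewrite ?mem_next_letters ?IHn ?le_a ?sz_s.
Qed.

Lemma extensions_uniq n l M : uniq (extensions n l M).
Proof.
elim: n l M => [|n IHn] l M //.
apply: allpairs_uniq_dep => [|a _|]; first exact: next_letters_uniq.
  exact: IHn.
by move=> [a s] [b t] _ _ [/= -> ->].
Qed.

(** Prepending 0 is a bijection from the extensions onto the words counted: both give duplicate-free
    lists with the same members. *)
Lemma catalan_num_021 n k :
  catalan_num [:: 0; 2; 1] n.+1 k =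
  count (fun s => descents_from 0 s == k) (extensions n 0 0).
Proof.
pose A := [set w in catalan_words [:: 0; 2; 1] n.+1
            | descents (map val (w : n.+1.-tuple 'I_n.+1)) == k].
rewrite /catalan_num -/A cardE -size_filter.
pose f (w : n.+1.-tuple 'I_n.+1) := map val w.
rewrite -(size_map f) -[RHS](size_map (cons 0)).
apply: perm_size; apply: uniq_perm.
- rewrite map_inj_uniq ?enum_uniq // => u v eq_uv.
  by apply: val_inj; apply: (inj_map val_inj).
- by rewrite map_inj_uniq ?filter_uniq ?extensions_uniq // => u v [].
move=> v; apply/mapP/mapP => [[w] | [s]].
  rewrite mem_enum !inE catalan_avoids_021 => w_in ->.
  have: size (f w) = n.+1 by rewrite size_map size_tuple.
  move: w_in; rewrite -/(f w); case: (f w) => // a s /andP[/andP[/eqP -> ext_s]].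
  rewrite descents_cons => des_s [sz_s]; exists s => //.
  by rewrite mem_filter mem_extensions des_s ext_s sz_s eqxx.
rewrite mem_filter mem_extensions => /and3P[des_s /eqP sz_s ext_s] ->.
have good_s : catalan_word (0 :: s) && avoids_pattern [:: 0; 2; 1] (0 :: s).
  by rewrite catalan_avoids_021.
(* The bound on letters ensures that [inord] leaves each of them unchanged. *)
have bnd := catalan_word_bound (proj1 (andP good_s)).
have sz_w : size (map (@inord n) (0 :: s)) == n.+1 by rewrite /= size_map sz_s.
have fw : f (Tuple sz_w) = 0 :: s.
  rewrite /f -map_comp map_id_in // => a /(allP bnd) /=.
  by rewrite sz_s => lt_a; rewrite inordK.
exists (Tuple sz_w) => //.
by rewrite mem_enum !inE -/(f _) fw good_s descents_cons.
Qed.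

End Words.

(** * Generating functions of the extensions *)

Definition ext_poly (l M n : nat) : fps int :=
  Fps (fun k => (count (fun s => descents_from l s == k) (extensions n l M))%:Z).

Definition ext_gf (l M : nat) : fps2 := Fps (ext_poly l M).

Lemma ext_poly0 l M : ext_poly l M 0 = 1.
Proof. by apply/fpsP => -[|k]. Qed.

(** Split by the first appended letter [a]; it creates a descent, hence a factor y, exactly when
    [a < l]. *)
Lemma ext_polyS l M n :
  ext_poly l M n.+1 =
  \sum_(a <- next_letters l M) fpsX int ^+ (a < l)%N * ext_poly a (maxn M a) n.
Proof.
apply/fpsP => k; rewrite fcoef_sum -[LHS]/(Posz (count _
  [seq a :: s | a <- next_letters l M, s <- extensions n a (maxn M a)])).
elim: (next_letters l M) => [|a r IHr]; first by rewrite big_nil.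
rewrite big_cons -IHr count_cat PoszD; congr (_ + _).
rewrite count_map; case: ltnP => [lt_al | le_la]; last first.
  by rewrite expr0 mul1r; congr Posz; apply: eq_count => s /=; rewrite ltnNge le_la.
rewrite expr1 fcoef_Xmul; case: k {IHr} => [|k].
  by rewrite (@eq_count _ _ pred0) ?count_pred0 // => s /=; rewrite lt_al.
by congr Posz; apply: eq_count => s /=; rewrite lt_al.
Qed.

Lemma ext_gfE l M :
  ext_gf l M = 1 + varx *
    \sum_(a <- next_letters l M) vary ^+ (a < l)%N * ext_gf a (maxn M a).
Proof.
apply/fpsP => -[|n]; rewrite fcoef_one_addX.
  exact: ext_poly0.
rewrite fcoef_sum [LHS]ext_polyS; apply: eq_bigr => a _.
by case: (a < l)%N; rewrite ?expr0 ?mul1r // !expr1 fcoef_Cmul.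
Qed.

Lemma next_letters0 M : (1 < M)%N -> next_letters 0 M = [:: 0%N].
Proof. by case: M => [|[|M]]. Qed.

Lemma next_letters_max M : (0 < M)%N -> next_letters M M = [:: 0; M; M.+1]%N.
Proof.
move=> M_gt0; rewrite /next_letters (maxn_idPr M_gt0).
by have -> : (M.+2 - M = 2)%N by lia.
Qed.

(** From such a state only 0 can follow, and the state then repeats. *)
Lemma ext_gf0_stable M : (1 < M)%N -> ext_gf 0 M = ext_gf 0 2.
Proof.
move=> M_gt1; apply/fpsP => n /=; elim: n => [|n IHn]; first by rewrite !ext_poly0.
by rewrite !ext_polyS !next_letters0 // !big_seq1 !maxn0 IHn.
Qed.

(** The next letters 0, [M], [M.+1] lead to a state with last letter 0, stable by the previous
    lemma, and to two states of the same kind, so induction on the length works once [M] is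
    generalized. *)
Lemma ext_gf_max_stable M : (1 < M)%N -> ext_gf M M = ext_gf 2 2.
Proof.
move=> M_gt1; apply/fpsP => n /=; elim: n M M_gt1 => [|n IHn] M M_gt1.
  by rewrite !ext_poly0.
have e0 : ext_poly 0 M n = ext_poly 0 2 n.
  by have /fpsP/(_ n) := ext_gf0_stable _ M_gt1.
rewrite !ext_polyS !next_letters_max ?(ltnW M_gt1) // !big_cons !big_nil.
rewrite !maxn0 !maxnn !(maxn_idPr (leqnSn _)) e0 (IHn M) // (IHn M.+1 (ltnW M_gt1)).
by rewrite (IHn 3) // !ltnn (ltnNge M.+1) leqnSn (ltnW M_gt1).
Qed.

Lemma catalan_gf_021 : catalan_gf [:: 0; 2; 1]%N = 1 + varx * ext_gf 0 0.
Proof.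
apply/fpsP => -[|n]; rewrite fcoef_one_addX.
  apply/fpsP => k /=; rewrite /catalan_num.
  have -> : [set w in catalan_words [:: 0; 2; 1]%N 0
              | descents (map val (w : 0.-tuple 'I_0)) == k]
            = if k == 0%N then setT else set0.
    apply/setP => w; rewrite !inE (tuple0 w) catalan_avoids_021 /= /descents.
    by rewrite eq_card0 => [|[]//]; case: k => [|k]; rewrite !inE.
  by case: k => [|k]; rewrite ?cardsT ?card_tuple ?cards0.
by apply/fpsP => k /=; rewrite catalan_num_021.
Qed.

(* The unknowns a, b1, b0, d, e stand for the states (0,0), (1,1), (0,1), (2,2)
   and (0,2). *)
Lemma solve_021_system (R : comNzRingType) (x y C a b1 b0 d e : R) :
  C = 1 + x * a ->
  a = 1 + x * (a + b1) ->
  b1 = 1 + x * (y * b0 + b1 + d) ->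
  b0 = 1 + x * (b0 + b1) ->
  d = 1 + x * (y * e + d + d) ->
  e = 1 + x * e ->
  C * ((1 - x) * (1 - 2 * x) * (1 - 2 * x + x ^+ 2 - x ^+ 2 * y)) =
  1 - 4 * x + 6 * x ^+ 2 - x ^+ 2 * y - 4 * x ^+ 3 + 3 * x ^+ 3 * y
    + x ^+ 4 - x ^+ 4 * y.
Proof.
move=> eC ea e1 e0 ed ee; apply/eqP; rewrite -subr_eq0; apply/eqP.
(* [Q] is the determinant of the pair of equations for [b1] and [b0]. The multipliers below are
   chosen so that every unknown except [C] cancels from the combination. *)
pose Q := 1 - 2 * x + x ^+ 2 - x ^+ 2 * y.
transitivity ((1 - x) * (1 - 2 * x) * Q * (C - (1 + x * a))
  + (1 - 2 * x) * Q * x * (a - (1 + x * (a + b1)))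
  + (1 - 2 * x) * x ^+ 2 * (1 - x) * (b1 - (1 + x * (y * b0 + b1 + d)))
  + (1 - 2 * x) * x ^+ 3 * y * (b0 - (1 + x * (b0 + b1)))
  + x ^+ 3 * (1 - x) * (d - (1 + x * (y * e + d + d)))
  + x ^+ 4 * y * (e - (1 + x * e))); first by rewrite /Q; ring.
by rewrite -eC -ea -e1 -e0 -ed -ee !subrr !mulr0 !addr0.
Qed.

Theorem theorem6 :
  let x := varx in
  let y := vary in
  catalan_gf [:: 0; 2; 1]%N =
    (1 - 4 * x + 6 * x ^+ 2 - x ^+ 2 * y - 4 * x ^+ 3 + 3 * x ^+ 3 * y
       + x ^+ 4 - x ^+ 4 * y)
    / ((1 - x) * (1 - 2 * x) * (1 - 2 * x + x ^+ 2 - x ^+ 2 * y)).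
Proof.
move=> x y; set D := (X in _ / X).
have unit_D : D \is a GRing.unit.
  (* This form shows that the constant coefficient in x is 1, which makes the series invertible. *)
  have -> : D = 1 + varx * (- 5 + 9 * x - x * y - 7 * x ^+ 2 + 3 * x ^+ 2 * y
                            + 2 * x ^+ 3 - 2 * x ^+ 3 * y).
    by rewrite /D /x; ring.
  by rewrite fps_unitE fcoef_one_addX unitr1.
apply: (canRL (mulrK unit_D)).
apply: (solve_021_system _ x y _ (ext_gf 0 0) (ext_gf 1 1) (ext_gf 0 1)
                         (ext_gf 2 2) (ext_gf 0 2)).
- exact: catalan_gf_021.
- by rewrite {1}ext_gfE !big_cons big_nil !expr0 !mul1r addr0.
- rewrite {1}ext_gfE next_letters_max // !big_cons big_nil /=.
  by rewrite expr1 !expr0 !mul1r addr0 addrA.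
- by rewrite {1}ext_gfE !big_cons big_nil !expr0 !mul1r addr0.
- rewrite {1}ext_gfE next_letters_max // !big_cons big_nil /=.
  (* The letter 3 leads to the state (3,3), which is identified with (2,2); this closes the
     system. *)
  by rewrite expr1 !expr0 !mul1r addr0 addrA (ext_gf_max_stable 3).
- by rewrite {1}ext_gfE next_letters0 // big_seq1 expr0 mul1r.
Qed.
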